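(* Let $p<q<r$ be primes and let $G$ be a group of order $pqr$. Then $G$ is capable if and only if $|Z(G)|=1$.
   Context: A group $G$ is called capable if there exists a group $H$ such that $G\cong H/Z(H)$. All groups here (including $H$) are finite. $Z(G)$ denotes the center of $G$. *)

(* Defs.v *)
From mathcomp Require Import all_boot all_fingroup all_solvable.

Set Implicit Arguments.
Unset Strict Implicit.
Unset Printing Implicit Defensive.

Local Open Scope group_scope.

Definition capable (gT : finGroupType) (G : {group gT}) : Prop :=
  exists (hT : finGroupType) (H : {group hT}), G \isog H / 'Z(H).

(* Main.v *)
Require Import Defs.
From mathcomp Require Import all_boot all_fingroup all_solvable.

(** Capability forces a trivial center for every finite group with cyclic Sylow
    subgroups.  If [xZ(H)] is central of prime order [l] in [H / Z(H)], then
    [y |-> [x, y]] is a morphism from [H] to the [l]-torsion of [Z(H)], so [x]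
    commutes with every [l']-element of [H].  The [l]-Sylow subgroups of
    [H / Z(H)] are cyclic and contain [xZ(H)], so [x] lies in the abelian group
    [S Z(H)] for each [l]-Sylow subgroup [S] of [H].  Hence [x] centralizes all
    Sylow subgroups of [H], i.e. [x] is in [Z(H)]. *)

Local Open Scope group_scope.

Lemma center_quotient_center_Zgroup {hT : finGroupType} (H : {group hT}) :
  Zgroup (H / 'Z(H)) -> 'Z(H / 'Z(H)) = 1.
Proof.
move=> zgHZ; apply/eqP; rewrite trivg_card1; apply/negPn/negP=> nZ1.
have Zgt1 : 1 < #|'Z(H / 'Z(H))| by rewrite ltn_neqAle eq_sym nZ1 cardG_gt0.
have [l l_pr /(Cauchy l_pr)[xb xbZ oxb]] := pdivP Zgt1.
have nZH : H \subset 'N('Z(H)) by rewrite normal_norm ?center_normal.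
have [xbHZ cxb] := setIP xbZ.
case/morphimP: xbHZ => x nx Hx /= xbE.
have commZ y : y \in H -> [~ x, y] \in 'Z(H).
  move=> Hy; have ny := subsetP nZH y Hy.
  apply: coset_idr; first by rewrite groupR.
  rewrite morphR //= -xbE; apply/eqP/commgP; apply: (centP cxb).
  by rewrite mem_quotient.
have xlZ : x ^+ l \in 'Z(H).
  by apply: coset_idr; rewrite ?groupX // morphX //= -xbE -oxb expg_order.
have centZ z y : z \in 'Z(H) -> y \in H -> commute z y.
  by case/setIP=> _ /centP cz Hy; apply: cz.
have commXl y : y \in H -> [~ x, y] ^+ l = 1.
  move=> Hy; rewrite -commXg; last by apply/commute_sym/centZ => //; apply: commZ.
  by apply/eqP/commgP; apply: centZ.
(* If [x] were central in [H], its coset [xb] would be trivial, yet [xb] has prime order [l]. *)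
suffices cHx : H \subset 'C[x].
  have xZ : x \in 'Z(H) by rewrite inE Hx -sub_cent1.
  by move: oxb l_pr; rewrite xbE coset_id // order1 => <-.
rewrite -(Sylow_gen H) gen_subG; apply/bigcupsP=> S /SylowP[s s_pr sylS].
have sSH := pHall_sub sylS.
have [eq_sl | ne_sl] := eqVneq s l; last first.
  apply/subsetP=> y Sy; have Hy := subsetP sSH y Sy.
  (* The order of [[~ x, y]] divides [l] and also [#[y]], a power of [s]; as [s] differs from [l],
     it is 1. *)
  have commXy : [~ x, y] ^+ #[y] = 1.
    rewrite -commgX; last by apply/commute_sym/centZ => //; apply: commZ.
    by rewrite expg_order commg1.
  rewrite cent1C; apply/cent1P/commgP; rewrite -order_eq1 -dvdn1.
  have co : coprime l #[y].
    have sy : s.-nat #[y] by apply: mem_p_elt Sy; apply: pHall_pgroup sylS.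
    apply: (@pnat_coprime l); first by rewrite pnat_id.
    by apply: sub_in_pnat sy => i _; rewrite !inE => /eqP->.
  by rewrite -(eqP co) dvdn_gcd !order_dvdn commXl // commXy !eqxx.
have nZS : S \subset 'N('Z(H)) by apply: subset_trans nZH.
have sylSZ : l.-Sylow(H / 'Z(H)) (S / 'Z(H)) by rewrite -eq_sl quotient_pHall.
have cycSZ : cyclic (S / 'Z(H)).
  by apply: (forall_inP zgHZ [group of S / 'Z(H)]); apply/SylowP; exists l.
(* Being central, [<[xb]>] is a normal [l]-subgroup, so every Sylow [l]-subgroup contains it. *)
have xbSZ : xb \in S / 'Z(H).
  rewrite -cycle_subG; apply: normal_sub_max_pgroup (Hall_max sylSZ) _ _.
    by rewrite /pgroup -orderE oxb pnat_id.
  by apply: sub_center_normal; rewrite cycle_subG.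
(* A group with a cyclic quotient by a central subgroup is abelian. *)
have abSZ : abelian (S <*> 'Z(H)).
  apply: (@cyclic_factor_abelian _ 'Z(H)%G); last by rewrite quotientYidr.
  rewrite subsetI joing_subr centY subsetI centsC.
  rewrite (subset_trans sSH) ?[H \subset _]centsC ?subsetIr //=.
  exact: center_abelian.
have xSZ : x \in S <*> 'Z(H).
  rewrite joingC norm_joinEr // -quotientK // mem_morphpre //= -xbE.
  exact: xbSZ.
apply/subsetP=> y Sy; rewrite cent1C; apply/cent1P.
by apply: (centsP abSZ) => //; rewrite mem_gen // inE Sy.
Qed.

(** For squarefree order, each Sylow subgroup is trivial or of prime order. *)
Lemma Zgroup_logn_le1 {gT : finGroupType} (G : {group gT}) :
  (forall s, prime s -> logn s #|G| <= 1) -> Zgroup G.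
Proof.
move=> logG; apply/forall_inP=> S /SylowP[s s_pr sylS].
have oS := card_Hall sylS; rewrite p_part in oS.
case: (logn s #|G|) (logG s s_pr) oS => [|[|//]] _ oS.
  by rewrite (card1_trivg oS) cyclic1.
by rewrite prime_cyclic // oS expn1.
Qed.

Local Close Scope group_scope.

Theorem proposition2p5 (p q r : nat) (gT : finGroupType) (G : {group gT})
    (p_pr : prime p) (q_pr : prime q) (r_pr : prime r)
    (ltpq : p < q) (ltqr : q < r) (oG : #|G| = p * q * r) :
  capable G <-> #|('Z(G))%g| = 1.
Proof.
split=> [[hT [H isoGH]] | /card1_trivg Z1]; last first.
  (* The witness is [G] itself. *)
  by exists gT, G; rewrite Z1 quotient1_isog.
rewrite (card_isog (isog_center isoGH)) /= center_quotient_center_Zgroup ?cards1 //.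
apply: Zgroup_logn_le1 => s s_pr; rewrite -(card_isog isoGH) oG.
(* The valuation becomes [(s == p) + (s == q) + (s == r)], where distinctness of the primes leaves
   at most one nonzero term. *)
rewrite !lognM ?muln_gt0 ?prime_gt0 // !logn_prime //.
have [->|] := eqVneq s p; last have [->|] := eqVneq s q.
- by rewrite (ltn_eqF ltpq) (ltn_eqF (ltn_trans ltpq ltqr)).
- by rewrite (ltn_eqF ltqr).
by case: (s == r).
Qed.
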